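(* For every $r \in \mathbb{N}$, $f_{total}(\mathscr{T}_{S^0} U_{r,n})$ is a polynomial of degree $r-1$ in $n$ whose leading coefficient is $\dfrac{4\cdot F_{r-1}}{(r-1)!}$.
   Context: $F_i=\sum_{k=0}^i k!\,S(i,k)$ is the $i$-th ordered Bell (Fubini) number, with $S(i,k)$ the Stirling number of the second kind. $U_{r,n}$ is the uniform matroid of rank $r$ on $[n]=\{1,\dots,n\}$ (its flats are $[n]$ and all subsets of size less than $r$). $S^0$ is the CW complex consisting of two points. For a matroid $M$ of rank $r$, $L(M)$ is its lattice of flats ordered by inclusion, $\operatorname{corank}(p)=r-\operatorname{rk}(p)$, $\Delta(P)$ is the order complex of a poset $P$, and $L(M)_{\le p}=\{q\in L(M): q\le p\}$. Engström representation with $X=S^0$. For $p\in L(M)$ let $D(p)$ be the join of $\operatorname{corank}(p)$ copies of $S^0$, indexed by $\{1,\dots,\operatorname{corank}(p)\}$ (the empty join is the empty space), with the standard cell structure of a join. For $p\ge q$ let $d_{pq}:D(p)\to D(q)$ be the inclusion induced by $\{1,\dots,\operatorname{corank}(p)\}\subseteq\{1,\dots,\operatorname{corank}(q)\}$. Then $$\mathscr{T}_{S^0} M = \coprod_{p\in L(M)} \bigl(\Delta(L(M)_{\le p})\times D(p)\bigr)\big/\sim,$$ where $\sim$ is the equivalence relation generated by: for $(a,x)\in\Delta(L(M)_{\le p})\times D(p)$ and $(b,y)\in\Delta(L(M)_{\le q})\times D(q)$, $(a,x)\sim(b,y)$ if $p\ge q$, $d_{pq}(x)=y$ and $a=b$.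 It is a CW complex whose open cells are the images of the open product cells $\sigma\times e$ of the spaces $\Delta(L(M)_{\le p})\times D(p)$ (identified cells being counted once). For a finite CW complex $\Delta$, $f_{total}(\Delta)$ is the total number of faces of $\Delta$ including the empty face, i.e. $1$ plus the number of cells.
   Formalization: Stated for r ≥ 1 (at r = 0 the degree −1 and (−1)! are meaningless), and the leading coefficient is claimed only for r ≥ 2: at r = 1 the total is the constant 3, not 4·F_0/0! = 4; polynomiality and degree r−1 are kept for r = 1. *)

(* Defs.v *)
From HB Require Import structures.
From Stdlib Require Import Relation_Operators.
From mathcomp Require Import all_boot all_order all_algebra.

Set Implicit Arguments.
Unset Strict Implicit.
Unset Printing Implicit Defensive.

Import Order.TTheory GRing.Theory Num.Theory.

Local Open Scope nat_scope.

(** ** Stirling numbers of the second kind and ordered Bell numbers *)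

(* [partition] forces the blocks to be nonempty. *)
Definition stirling2 (i k : nat) : nat :=
  #|[set P : {set {set 'I_i}} | partition P [set: 'I_i] & #|P| == k]|.

Definition ordered_bell (i : nat) : nat := \sum_(k < i.+1) k`! * stirling2 i k.

(** ** Matroids *)

Record matroid (E : finType) := Matroid {
  indep : {set {set E}};
  indep0 : set0 \in indep;
  indepS : forall A B : {set E},
    A \subset B -> B \in indep -> A \in indep;
  indep_aug : forall A B : {set E},
    A \in indep -> B \in indep -> #|A| < #|B| ->
    exists2 x, x \in B :\: A & x |: A \in indep
}.

Section MatroidTheory.
Variables (E : finType) (M : matroid E).

Definition mrank (A : {set E}) : nat :=
  \max_(I : {set E} | (I \in indep M) && (I \subset A)) #|I|.

Definition is_flat (F : {set E}) : bool :=
  [forall x, (x \notin F) ==> (mrank F < mrank (x |: F))].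

(* The lattice of flats; its order is inclusion of the underlying sets. *)
Definition flat : finType := {F : {set E} | is_flat F}.

Definition corank (p : flat) : nat := mrank [set: E] - mrank (val p).

Lemma mrankS (A B : {set E}) : A \subset B -> mrank A <= mrank B.
Proof.
move=> sAB; apply/bigmax_leqP => I /andP[iI sIA].
by apply: leq_bigmax_cond; rewrite iI (subset_trans sIA sAB).
Qed.

Lemma corankS (p q : flat) : val q \subset val p -> corank p <= corank q.
Proof. by move=> qp; rewrite /corank leq_sub2l// mrankS. Qed.

End MatroidTheory.

Section Uniform.
Variables r n : nat.

Definition uniform_indep : {set {set 'I_n}} :=
  [set A : {set 'I_n} | #|A| <= r].

Fact uniform_indep0 : set0 \in uniform_indep.
Proof. by rewrite inE cards0. Qed.

Fact uniform_indepS (A B : {set 'I_n}) :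
  A \subset B -> B \in uniform_indep -> A \in uniform_indep.
Proof. by rewrite !inE => /subset_leq_card; exact: leq_trans. Qed.

Fact uniform_indep_aug (A B : {set 'I_n}) :
  A \in uniform_indep -> B \in uniform_indep -> #|A| < #|B| ->
  exists2 x, x \in B :\: A & x |: A \in uniform_indep.
Proof.
rewrite !inE => _ Br AB.
have /subsetPn[x xB xA] : ~~ (B \subset A).
  by apply: contraL AB => /subset_leq_card; rewrite -leqNgt.
exists x; first by rewrite inE xA.
by rewrite inE cardsU1 xA (leq_trans AB).
Qed.

(* This has rank [minn r n]; it is the uniform matroid of rank [r] when
   [r <= n]. *)
Definition uniform_matroid : matroid 'I_n :=
  Matroid uniform_indep0 uniform_indepS uniform_indep_aug.

End Uniform.

(** ** Finite simplicial complexes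

  A complex on the vertex set [V] is given by its set of faces.  The empty set
  may or may not be listed as a face: it carries no point of the geometric
  realization and is never counted as a cell. *)

Definition order_complex (T : finType) (le : rel T) (P : {set T}) :
    {set {set T}} :=
  [set s : {set T} | (s \subset P) &&
    [forall x in s, forall y in s, le x y || le y x]].

Definition S0_complex : {set {set bool}} := [set s : {set bool} | #|s| <= 1].

(* Join of copies of [K] indexed by [I]: a face is a disjoint union of (possibly
   empty) faces, one for each index. *)
Definition join_complex (I V : finType) (K : {set {set V}}) :
    {set {set I * V}} :=
  [set s : {set I * V} | [forall i, [set v | (i, v) \in s] \in K]].

(* Loaded only here because [classical_sets] shadows names of [finset] used
   above ([set0], [partition], set comprehensions). *)
From mathcomp Require Import generic_quotient finmap.
From mathcomp Require Import all_classical all_reals.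
From mathcomp Require Import topology_structure initial_topology.
From mathcomp Require Import product_topology sigT_topology subtype_topology.
From mathcomp Require Import quotient_topology num_topology function_spaces.

(** ** Geometric realization and the Engstrom representation *)

Import numFieldTopology.Exports.

Section Realization.
Local Open Scope classical_set_scope.
Local Open Scope ring_scope.
Variable R : realType.

Definition support_set (V : finType) (x : V -> R) : {set V} :=
  [set v | x v != 0]%SET.

(* Barycentric coordinates, with the topology induced from the product [R^V]. *)
Definition realization (V : finType) (K : {set {set V}}) :
    set (prod_topology (fun _ : V => R)) :=
  [set x | [/\ forall v, 0 <= x v, \sum_(v : V) x v = 1
             & support_set x \in K] ].

(* The affine extension of a map [f] between vertex sets. *)
Definition affine_map (V W : finType) (f : V -> W) (x : V -> R) : W -> R :=
  fun w => \sum_(v : V | f v == w) x v.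

Section Engstrom.
Variables (E : finType) (M : matroid E).

Definition lower (p : flat M) : {set flat M} :=
  [set q : flat M | val q \subset val p]%SET.

Definition flat_complex (p : flat M) : {set {set flat M}} :=
  order_complex (fun q1 q2 : flat M => val q1 \subset val q2) (lower p).

Definition D_complex (p : flat M) : {set {set 'I_(corank p) * bool}} :=
  join_complex 'I_(corank p) S0_complex.

Definition d_vertex (p q : flat M) (qp : val q \subset val p)
    (v : 'I_(corank p) * bool) : 'I_(corank q) * bool :=
  (widen_ord (corankS qp) v.1, v.2).

Definition engstrom_sum : topologicalType :=
  {p : flat M &
    (set_type (realization (flat_complex p)) *
     set_type (realization (D_complex p)))%type}.

(* [(a, x)] over [p] and [(b, y)] over [q] with [p >= q], [d_pq x = y] and
   [a = b]; equalities are between coordinate functions, since [a] and [b]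
   (resp. [d_pq x] and [y]) live in different subspaces of a common space. *)
Definition engstrom_step (u v : engstrom_sum) : Prop :=
  exists qp : val (projT1 v) \subset val (projT1 u),
    affine_map (d_vertex qp) (set_val (projT2 u).2) = set_val (projT2 v).2 /\
    set_val (projT2 u).1 = set_val (projT2 v).1.

Definition engstrom_rel (u v : engstrom_sum) : bool :=
  `[< clos_refl_sym_trans engstrom_sum engstrom_step u v >].

Fact engstrom_rel_equiv : equiv_class_of engstrom_rel.
Proof.
split=> [u|u v|v u w]; rewrite /engstrom_rel.
- exact/asboolP/rst_refl.
- by apply/asboolP/asboolP; exact: rst_sym.
- by move=> /asboolP uv /asboolP vw; apply/asboolP; exact: rst_trans uv vw.
Qed.

Canonical engstrom_equiv := EquivRelPack engstrom_rel_equiv.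

Definition engstrom_space : topologicalType :=
  quotient_topology {eq_quot engstrom_equiv}%qT.

Definition engstrom_proj (u : engstrom_sum) : engstrom_space :=
  (\pi_(engstrom_space) u)%qT.

Definition product_cell (p : flat M) (s : {set flat M})
    (e : {set 'I_(corank p) * bool}) : set engstrom_sum :=
  [set u | exists ax, [/\ u = existT _ p ax,
     support_set (set_val ax.1) = s & support_set (set_val ax.2) = e] ].

Definition engstrom_cells : set (set engstrom_space) :=
  [set C | exists p s e,
     [/\ s \in flat_complex p, s != finset.set0,
         e \in D_complex p, e != finset.set0
       & C = engstrom_proj @` product_cell s e] ].

End Engstrom.
End Realization.

(** ** Cell complexes and face numbers *)

(* A topological space with the set of its open cells.  The CW axioms are not
   part of the structure, since face numbers depend on the set of cells only. *)
Record cell_complex := CellComplex {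
  carrier : topologicalType;
  open_cells : set (set carrier)
}.
Arguments open_cells X : clear implicits, rename.

(* [fset_set] turns a finite classical set into a finite set (an infinite one is
   sent to the empty set); the added 1 is the empty face. *)
Definition f_total (X : cell_complex) : nat :=
  #|` fset_set (open_cells X)|%fset.+1.

Definition engstrom_S0 (R : realType) (E : finType) (M : matroid E) :
    cell_complex :=
  CellComplex (@engstrom_cells R E M).

(* Main.v *)
Require Import Defs.
From mathcomp Require Import all_boot all_order all_algebra.
From mathcomp Require Import zify.

(** Every point of the Engstrom representation is glued to a point over the top
    flat of the chain that carries it, and to no other point over that flat
    ([cell_restrict], [cell_inj]).  A cell is therefore the same thing as a
    nonempty chain of flats, with top [p] say, and a nonempty face of [D p].  As
    [D p] is a join of [corank p] copies of two points it has [3 ^ corank p]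
    faces, the empty one included, and [f_total_engstrom] follows: [f_total] is
      1 + \sum_p (number of chains with top p) * (3 ^ corank p - 1).

    For the uniform matroid the flats of positive corank are the sets of size
    [k < r]; there are ['C(n, k)] of them for each [k], their corank is [r - k],
    and the lattice of flats below them is Boolean.  A chain of subsets with top
    a given [k]-set is essentially an ordered partition of that set, so there are
    [boolean_chains k] of them, which is twice the ordered Bell number for
    [k > 0]: both counts obey the same recurrence ([card_chains_uniform],
    [boolean_chains_rec]).  Hence [f_total] is
      1 + \sum_(k < r) boolean_chains k * (3 ^ (r - k) - 1) * 'C(n, k),
    a polynomial in [n] of degree [r - 1]; the top term [k = r - 1] gives the
    leading coefficient 2 * F_(r-1) * (3 - 1) / (r-1)! when [r > 1]. *)

Set Implicit Arguments.
Unset Strict Implicit.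
Unset Printing Implicit Defensive.

(** * Set partitions and ordered Bell numbers *)

Lemma sum_subsets_card_lt (T : finType) (A : {set T}) (m : nat) (f : nat -> nat) :
  \sum_(B : {set T} | (B \subset A) && (#|B| < m)) f #|B| =
  \sum_(j < m) 'C(#|A|, j) * f j.
Proof.
pose P (B : {set T}) := (B \subset A) && (#|B| < m).
transitivity (\sum_(j < m) \sum_(B | P B && (#|B| == j)) f #|B|).
  rewrite (exchange_big_dep P) /=; last by move=> j B _ /andP[].
  apply: eq_bigr => B PB; have /andP[BA Bm] := PB.
  by rewrite (big_pred1 (Ordinal Bm)) // => j; rewrite /P BA Bm eq_sym.
apply: eq_bigr => j _; rewrite -cards_draws -sum_nat_const.
apply: eq_big => [B|B /andP[_ /eqP-> //]]; rewrite !inE /P.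
by case: eqP => [->|]; rewrite ?andbF // ltn_ord !andbT.
Qed.

Lemma sum_proper_card (T : finType) (A : {set T}) (f : nat -> nat) :
  \sum_(B : {set T} | B \proper A) f #|B| =
  \sum_(j < #|A|) 'C(#|A|, j) * f j.
Proof.
by rewrite -sum_subsets_card_lt; apply: eq_bigl => B; rewrite properEcard.
Qed.

Definition partitions_of (T : finType) (A : {set T}) (k : nat) :
    {set {set {set T}}} :=
  [set P : {set {set T}} | partition P A & #|P| == k].

(** Deleting the block [B], and putting it back, are inverse bijections. *)
Lemma card_partitions_with_block (T : finType) (A B : {set T}) k :
  B != set0 -> B \subset A ->
  #|[set P in partitions_of A k.+1 | B \in P]| = #|partitions_of (A :\: B) k|.
Proof.
move=> B0 BA.
have dB : [disjoint B & A :\: B].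
  by rewrite disjoint_sym disjoints_subset setDE subsetIr.
have BN Q : Q \in partitions_of (A :\: B) k -> B \notin Q.
  rewrite inE => /andP[/and3P[/eqP cQ _ _] _]; apply/negP => BQ.
  have sB : B \subset A :\: B by rewrite -cQ; exact: (bigcup_sup B).
  by case/negP: B0; rewrite -subset0 -(setIidPl sB) (disjoint_setI0 dB).
rewrite -[RHS](card_in_imset (f := fun Q => B |: Q)); last first.
  move=> Q Q' /BN BQ /BN BQ' e.
  by rewrite -(setU1K BQ) -(setU1K BQ') e.
congr #|pred_of_set _|; apply/setP=> P; rewrite !inE; apply/idP/imsetP.
  move=> /andP[/andP[pP /eqP cP] BP]; exists (P :\ B); last by rewrite setD1K.
  by rewrite inE partitionD1 //=; move/eqP: cP; rewrite (cardsD1 B) BP.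
move=> [Q QP ->]; have BQ := BN _ QP; move: QP; rewrite inE => /andP[pQ /eqP cQ].
rewrite setU11 andbT cardsU1 BQ cQ eqxx andbT.
by rewrite -[X in partition _ X](setID A B) (setIidPr BA); apply: partitionU1.
Qed.

(** Double counting of the partitions of [A] with a marked block: the index [C]
    is the complement in [A] of the marked block, so it ranges over the proper
    subsets because blocks are nonempty. *)
Lemma card_partitions_rec (T : finType) (A : {set T}) k :
  k.+1 * #|partitions_of A k.+1| =
  \sum_(C : {set T} | C \proper A) #|partitions_of C k|.
Proof.
transitivity (\sum_(P in partitions_of A k.+1) \sum_(B in P) 1).
  rewrite mulnC -sum_nat_const; apply: eq_bigr => P.
  by rewrite inE => /andP[_ /eqP <-]; rewrite sum1_card.
rewrite (exchange_big_dep (fun B : {set T} => (B != set0) && (B \subset A))) /=.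
  rewrite [RHS](reindex_onto (fun B => A :\: B) (fun B => A :\: B)) /=; last first.
    by move=> C /proper_sub CA; rewrite setDDr setDv set0U (setIidPr CA).
  apply: eq_big => [B|B /andP[B0 BA]].
    rewrite setDDr setDv set0U; apply/andP/andP.
      move=> [B0 BA]; rewrite (setIidPr BA) eqxx; split=> //.
      rewrite properE subsetDl /=; apply/negP => AB; case/negP: B0.
      rewrite -subset0; apply/subsetP => x xB.
      by have := subsetP AB x (subsetP BA x xB); rewrite inE xB.
    move=> [pr /eqP/setIidPr BA]; split=> //.
    by apply/negP => /eqP B0; move: pr; rewrite B0 setD0 properxx.
  rewrite -(card_partitions_with_block _ B0 BA) -sum1_card.
  by apply: eq_bigl => P; rewrite !inE.
move=> P B; rewrite inE => /andP[/and3P[/eqP cP _ P0] _] BP; apply/andP; split.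
  by apply: contraNneq P0 => <-.
by rewrite -cP; apply: (bigcup_sup B).
Qed.

Lemma card_partitions_0 (T : finType) (A : {set T}) :
  #|partitions_of A 0| = (A == set0).
Proof.
have -> : partitions_of A 0 = if A == set0 then [set set0] else set0.
  apply/setP=> P; rewrite inE cards_eq0.
  case: (eqVneq P set0) => [->|P0]; last first.
    by rewrite andbF; case: ifP; rewrite !inE ?(negPf P0).
  rewrite andbT; case: (eqVneq A set0) => [->|A0]; rewrite !inE ?eqxx.
    by rewrite partition_set0 eqxx.
  apply/negP => /cover_partition; rewrite /cover big_set0 => e.
  by rewrite -e eqxx in A0.
by case: ifP; rewrite ?cards1 ?cards0.
Qed.

(** Both sides obey the recurrence [card_partitions_rec], which involves only
    cardinals; this replaces transporting partitions along a bijection of [A]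
    with an ordinal. *)
Lemma card_partitions (T : finType) (A : {set T}) k :
  #|partitions_of A k| = stirling2 #|A| k.
Proof.
rewrite /stirling2 -/(partitions_of _ _).
elim: k T A => [|k IH] T A.
  by rewrite !card_partitions_0 -!cards_eq0 cardsT card_ord.
apply/eqP; rewrite -(eqn_pmul2l (ltn0Sn k)) !card_partitions_rec; apply/eqP.
under eq_bigr do rewrite IH.
under [RHS]eq_bigr do rewrite IH.
pose S j := #|partitions_of [set: 'I_j] k|.
by rewrite !(sum_proper_card _ S) cardsT card_ord.
Qed.

Lemma stirling2_0 i : stirling2 i 0 = (i == 0).
Proof.
rewrite -{1}(card_ord i) -cardsT -card_partitions card_partitions_0.
by rewrite -cards_eq0 cardsT card_ord.
Qed.

Lemma stirling2_rec i k :
  k.+1 * stirling2 i k.+1 = \sum_(j < i) 'C(i, j) * stirling2 j k.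
Proof.
have iE : #|[set: 'I_i]| = i by rewrite cardsT card_ord.
rewrite -{1}iE -card_partitions card_partitions_rec.
under eq_bigr do rewrite card_partitions.
by rewrite (sum_proper_card _ (stirling2^~ k)) iE.
Qed.

Lemma stirling2_small i k : i < k -> stirling2 i k = 0.
Proof.
elim: k i => // k IH i ik; apply/eqP; rewrite -(eqn_pmul2l (ltn0Sn k)) muln0.
rewrite stirling2_rec big1 // => j _; rewrite IH ?muln0 //.
by apply: leq_trans (ltn_ord j) _.
Qed.

Lemma ordered_bell_0 : ordered_bell 0 = 1.
Proof. by rewrite /ordered_bell big_ord1 stirling2_0. Qed.

(** An ordered partition of a nonempty [i]-set is a nonempty last block together
    with an ordered partition of its complement, which has [j < i] elements. *)
Lemma ordered_bell_rec i : 0 < i ->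
  ordered_bell i = \sum_(j < i) 'C(i, j) * ordered_bell j.
Proof.
move=> i0; rewrite /ordered_bell big_ord_recl stirling2_0 gtn_eqF // muln0 add0n.
transitivity (\sum_(k < i) \sum_(j < i) 'C(i, j) * (k`! * stirling2 j k)).
  apply: eq_bigr => k _; rewrite lift0 factS mulnAC stirling2_rec big_distrl /=.
  by apply: eq_bigr => j _; rewrite mulnAC mulnA.
rewrite exchange_big; apply: eq_bigr => j _; rewrite -big_distrr /=; congr (_ * _).
(* [stirling2 j k] vanishes for [k > j], so the inner sum may stop at [j]. *)
rewrite (big_ord_widen_cond i xpredT (fun k => k`! * stirling2 j k) (ltn_ord j)).
rewrite [RHS]big_mkcond; apply: eq_bigr => k _ /=.
by rewrite ltnS; case: leqP => // jk; rewrite stirling2_small ?muln0.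
Qed.

(** The number of chains with greatest element [A] in the lattice of subsets of a
    set [A] of size [k].  If [k > 0], taking successive differences turns the
    chains that start at the empty set into the ordered partitions of [A], and
    dropping the empty set pairs them with the other chains: hence the
    factor 2.  If [k = 0] there is a single chain. *)
Definition boolean_chains k := (0 < k).+1 * ordered_bell k.

(** The recurrence for chains ending in a fixed top: either the top is alone, or
    the rest of the chain has its own top, a proper subset of size [j]. *)
Lemma boolean_chains_rec k :
  boolean_chains k = 1 + \sum_(j < k) 'C(k, j) * boolean_chains j.
Proof.
case: k => [|k]; first by rewrite big_ord0 /boolean_chains ordered_bell_0.
rewrite /boolean_chains ordered_bell_rec // !big_ord_recl bin0 ordered_bell_0 /=.
(* The term [j = 0], worth 1, is doubled on the left; on the right it is single,
   and the isolated summand 1 completes it. *)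
rewrite mulnDr big_distrr /= !mul1n muln1 addnA; congr (_ + _).
by apply: eq_bigr => j _; rewrite mulnCA.
Qed.

Lemma ordered_bell_gt0 k : 0 < ordered_bell k.
Proof.
case: k => [|k]; first by rewrite ordered_bell_0.
by rewrite ordered_bell_rec // big_ord_recl bin0 ordered_bell_0.
Qed.

(** * Faces of joins and chains of flats *)

(** A face of the join is a choice of one face, possibly empty, in each factor. *)
Lemma card_join_complex (I V : finType) (K : {set {set V}}) :
  #|join_complex I K| = #|K| ^ #|I|.
Proof.
rewrite -card_ffun_on -[LHS](card_in_imset
  (f := fun s : {set I * V} => [ffun i => [set v | (i, v) \in s]])).
  apply: eq_card => g.
  apply/imsetP/ffun_onP => [[s]|gK].
    by rewrite inE => /forallP sK -> i; rewrite ffunE.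
  exists [set iv | iv.2 \in g iv.1]; first rewrite inE.
    apply/forallP => i; rewrite (_ : [set v | _] = g i) //.
    by apply/setP => v; rewrite !inE.
  by apply/ffunP => i; rewrite ffunE; apply/setP => v; rewrite !inE.
move=> s t _ _ /ffunP e; apply/setP=> -[i v].
by have /setP/(_ v) := e i; rewrite !ffunE !inE.
Qed.

Lemma card_S0_complex : #|S0_complex| = 3.
Proof.
have -> : S0_complex = set0 |: [set [set b] | b : bool].
  apply/setP=> s; rewrite !inE leq_eqVlt ltnS leqn0 cards_eq0 orbC; congr (_ || _).
  by apply/cards1P/imsetP => [[b ->]|[b _ ->]]; exists b.
rewrite cardsU1 card_imset ?card_bool; last exact: set1_inj.
by case: imsetP => // -[b _ /setP/(_ b)]; rewrite !inE eqxx.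
Qed.

Section Chains.
Variables (E : finType) (M : matroid E).
Implicit Types (p q : flat M) (s t : {set flat M}).

Definition chains_with_top p := [set s in flat_complex p | p \in s].

Lemma flat_complexP p s : reflect
  ((forall q, q \in s -> val q \subset val p) /\
   (forall q1 q2, q1 \in s -> q2 \in s ->
      (val q1 \subset val q2) || (val q2 \subset val q1)))
  (s \in flat_complex p).
Proof.
rewrite inE; apply: (iffP andP) => -[sp sC]; split.
- by move=> q /(subsetP sp); rewrite inE.
- by move=> q1 q2 q1s q2s; have /forall_inP/(_ _ q1s)/forall_inP/(_ _ q2s) := sC.
- by apply/subsetP => q /sp; rewrite inE.
- by apply/forall_inP => q1 q1s; apply/forall_inP => q2 q2s; exact: sC.
Qed.

Lemma chains_with_topE p s :
  (s \in chains_with_top p) = (s \in flat_complex p) && (p \in s).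
Proof. by rewrite inE. Qed.

(** A flat of largest cardinal in a chain contains all the others. *)
Lemma chain_has_top p s : s \in flat_complex p -> s != set0 ->
  exists2 q : flat M, val q \subset val p & s \in chains_with_top q.
Proof.
move=> /flat_complexP[sp sC] /set0Pn[q0 q0s].
have [q qs qmax] := @arg_maxnP _ q0 (mem s) (fun q : flat M => #|val q|) q0s.
exists q; first exact: sp.
rewrite inE (_ : q \in s) // andbT; apply/flat_complexP; split=> // q' q's.
have /orP[//|qq'] := sC _ _ q's qs.
have /eqP <- : val q == val q' by rewrite eqEcard qq'; apply: (qmax q' q's).
exact: subxx.
Qed.

Lemma chain_top_uniq p q s :
  s \in chains_with_top p -> s \in chains_with_top q -> p = q.
Proof.
rewrite !chains_with_topE.
move=> /andP[/flat_complexP[sp _] ps] /andP[/flat_complexP[sq _] qs].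
by apply/val_inj/eqP; rewrite eqEsubset sq // sp.
Qed.

(** A chain with top [q] extends by any flat above [q]; this inverts the removal
    of the top [p] in [card_chains_with_top]. *)
Lemma chains_with_topU p q t : val q \proper val p -> t \in chains_with_top q ->
  (p \notin t) && (p |: t \in chains_with_top p).
Proof.
move=> /andP[qp pq]; rewrite inE => /andP[/flat_complexP[tq tC] qt].
apply/andP; split; first by apply: contra pq => /tq.
have tp q' : q' \in p |: t -> val q' \subset val p.
  by move=> /setU1P[-> //|/tq q'q]; exact: subset_trans qp.
rewrite inE setU11 andbT; apply/flat_complexP; split=> // q1 q2 h1 h2.
move: (h1) (h2) => /setU1P[->|q1t] /setU1P[->|q2t].
- by rewrite subxx.
- by rewrite (tp _ h2) orbT.
- by rewrite (tp _ h1).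
- exact: tC.
Qed.

(** Removing [p] from a chain with top [p] leaves the empty set, or a chain with
    a unique top [q] strictly below [p]. *)
Lemma card_chains_with_top p :
  #|chains_with_top p| =
  1 + \sum_(q : flat M | val q \proper val p) #|chains_with_top q|.
Proof.
have p1 : [set p] \in chains_with_top p.
  rewrite inE set11 andbT; apply/flat_complexP.
  by split=> [q|q1 q2] => /set1P->; rewrite ?subxx // => /set1P->; rewrite subxx.
rewrite -sum1_card (bigD1 _ p1) /=; congr (_ + _).
pose D s := (s \in chains_with_top p) && (s != [set p]).
pose below s q := (val q \proper val p) && (s :\ p \in chains_with_top q).
transitivity (\sum_(s | D s) \sum_(q | below s q) 1).
  apply: eq_bigr => s Ds; have /andP[] : D s := Ds.
  rewrite chains_with_topE => /andP[/flat_complexP[sp sC] ps] s1.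
  have [q _ qs] : exists2 q : flat M,
      val q \subset val p & s :\ p \in chains_with_top q.
    apply: chain_has_top.
      apply/flat_complexP; split=> [q|q1 q2] /setD1P[_]; first exact: sp.
      by move=> q1s /setD1P[_]; exact: sC.
    by apply: contraNneq s1 => e; rewrite -(setD1K ps) e setU0.
  rewrite (big_pred1 q) // => q'; apply/andP/eqP => [[_ q's]|->].
    exact: chain_top_uniq q's qs.
  split=> //; have : q \in s :\ p by move: qs; rewrite inE => /andP[].
  move=> /setD1P[qp /sp sqp]; rewrite properEneq sqp andbT.
  by apply: contraNneq qp => /val_inj ->.
rewrite (exchange_big_dep (fun q => val q \proper val p)) /=; last first.
  by move=> s q _ /andP[].
apply: eq_bigr => q qp; rewrite sum1dep_card.
rewrite -[RHS](card_in_imset (f := fun t => p |: t)); last first.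
  move=> t t' /(chains_with_topU qp)/andP[pt _].
  move=> /(chains_with_topU qp)/andP[pt' _] e.
  by rewrite -(setU1K pt) -(setU1K pt') e.
apply: eq_card => s; rewrite inE; apply/idP/imsetP.
  move=> /andP[/andP[+ _] /andP[_ sq]]; rewrite chains_with_topE => /andP[_ ps].
  by exists (s :\ p); rewrite ?setD1K.
move=> [t tq ->]; have /andP[pt ptC] := chains_with_topU qp tq.
rewrite /D ptC /below setU1K // qp tq /= andbT; apply/eqP => e.
have : q \in p |: t.
  by apply: setU1r; move: tq; rewrite chains_with_topE => /andP[].
by rewrite e => /set1P qpE; move: qp; rewrite qpE properxx.
Qed.

End Chains.

(** * Flats of uniform matroids *)

Section UniformFlats.
Variables r n : nat.
Hypothesis rn : r <= n.
Let U := uniform_matroid r n.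

Lemma mrank_uniform (A : {set 'I_n}) : mrank U A = minn r #|A|.
Proof.
apply/eqP; rewrite eqn_leq; apply/andP; split.
  by apply/bigmax_leqP => I /andP[]; rewrite inE leq_min => -> /subset_leq_card.
have : 0 < #|[set B : {set 'I_n} | B \subset A & #|B| == minn r #|A|]|.
  by rewrite cards_draws bin_gt0 geq_minr.
case/card_gt0P => B; rewrite inE => /andP[BA /eqP BE].
by rewrite -BE; apply: leq_bigmax_cond; rewrite BA andbT inE BE geq_minl.
Qed.

Lemma is_flat_uniform (A : {set 'I_n}) :
  is_flat U A = (#|A| < r) || (A == [set: 'I_n]).
Proof.
apply/forallP/orP => [fA|[Ar x|/eqP-> x]]; last by rewrite inE.
  case: (ltnP #|A| r) => rA; [by left|right].
  rewrite -subTset; apply/subsetP => x _; apply: contraT => xA; have := fA x.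
  by rewrite xA /= !mrank_uniform cardsU1 xA; lia.
by apply/implyP => xA; rewrite !mrank_uniform cardsU1 xA; lia.
Qed.

(** Every set of size less than [r] is a flat, so sums over such flats are sums
    over sets. *)
Lemma sum_flats_uniform (P : pred {set 'I_n}) (f : {set 'I_n} -> nat) :
  (forall A, P A -> #|A| < r) ->
  \sum_(p : flat U | P (val p)) f (val p) = \sum_(A : {set 'I_n} | P A) f A.
Proof.
move=> Pr; rewrite [RHS](reindex_omap (val : flat U -> _) insub) /=; last first.
  by move=> A /Pr Ar; rewrite insubT //= is_flat_uniform Ar.
by apply: eq_bigl => p; rewrite valK eqxx andbT.
Qed.

Lemma corank_uniform (p : flat U) : corank p = r - #|val p|.
Proof. by rewrite /corank !mrank_uniform cardsT card_ord; lia. Qed.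

(** Below a flat of size less than [r] the lattice of flats is Boolean, so the
    two recurrences agree. *)
Lemma card_chains_uniform (p : flat U) :
  #|val p| < r -> #|chains_with_top p| = boolean_chains #|val p|.
Proof.
have [m] := ubnP #|val p|; elim: m p => // m IH p; rewrite ltnS => pm pr.
rewrite card_chains_with_top boolean_chains_rec -sum_proper_card; congr (_ + _).
rewrite -sum_flats_uniform.
  apply: eq_bigr => q /proper_card qp.
  by apply: IH; [exact: leq_trans pm | exact: ltn_trans pr].
by move=> A /proper_card Ap; exact: ltn_trans pr.
Qed.

(** The whole ground set has corank 0 and contributes nothing; the other flats
    are the sets of size [k < r], of corank [r - k]. *)
Lemma sum_chains_uniform :
  \sum_(p : flat U) #|chains_with_top p| * (3 ^ corank p).-1 =
  \sum_(k < r) 'C(n, k) * (boolean_chains k * (3 ^ (r - k)).-1).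
Proof.
pose f k := boolean_chains k * (3 ^ (r - k)).-1.
transitivity (\sum_(p : flat U | #|val p| < r) f #|val p|).
  rewrite [RHS]big_mkcond; apply: eq_bigr => p _; rewrite corank_uniform.
  case: ltnP => pr; first by rewrite card_chains_uniform.
  by move: pr; rewrite -subn_eq0 => /eqP->; rewrite muln0.
rewrite (@sum_flats_uniform (fun A => #|A| < r) (fun A => f #|A|)) //.
have := sum_subsets_card_lt [set: 'I_n] r f; rewrite cardsT card_ord => <-.
by apply: eq_bigl => A; rewrite subsetT.
Qed.

End UniformFlats.

(** * The cells of the Engstrom representation *)

From Stdlib Require Import Relation_Operators.
From mathcomp Require Import generic_quotient finmap.
From mathcomp Require Import all_classical all_reals.
From mathcomp Require Import topology_structure.

Import GRing.Theory Num.Theory.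
Local Open Scope classical_set_scope.
Local Open Scope ring_scope.

Section Realization.
Variable R : realType.

Lemma affine_map_inj (V W : finType) (f : V -> W) (x : V -> R) (v : V) :
  injective f -> affine_map f x (f v) = x v.
Proof.
by move=> fI; rewrite /affine_map (big_pred1 v) // => u; rewrite (inj_eq fI).
Qed.

Lemma affine_map_out (V W : finType) (f : V -> W) (x : V -> R) (w : W) :
  (forall v, f v != w) -> affine_map f x w = 0.
Proof. by move=> fw; rewrite /affine_map big_pred0 // => v; exact: negbTE. Qed.

Lemma support_affine_map (V W : finType) (f : V -> W) (x : V -> R) :
  injective f -> support_set (affine_map f x) = f @: support_set x.
Proof.
move=> fI; apply/setP => w; rewrite inE; apply/idP/imsetP => [|[v + ->]]; last first.
  by rewrite inE affine_map_inj.
have [v /eqP <-|fw] := pickP (fun v => f v == w).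
  by rewrite affine_map_inj // => xv; exists v; rewrite ?inE.
by rewrite affine_map_out ?eqxx // => v; rewrite fw.
Qed.

Lemma realization_affine_map (V W : finType) (K : {set {set V}})
    (L : {set {set W}}) (f : V -> W) (x : V -> R) :
  injective f -> realization K x -> f @: support_set x \in L ->
  realization L (affine_map f x).
Proof.
move=> fI [x0 x1 xK] fL; split.
- by move=> w; apply: sumr_ge0 => v _; exact: x0.
- by rewrite -[RHS]x1 (partition_big f xpredT).
- by rewrite support_affine_map.
Qed.

Lemma support_comp (V W : finType) (e : {set V}) (f : V -> W) (y : W -> R) :
  injective f -> support_set y = f @: e -> support_set (y \o f) = e.
Proof.
move=> fI ye; apply/setP => v; rewrite -(mem_imset e v fI) -ye !inE //.
Qed.

(** Outside the image of [f] both sides vanish, the right one because of its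
    support. *)
Lemma affine_map_comp (V W : finType) (e : {set V}) (f : V -> W) (y : W -> R) :
  injective f -> support_set y = f @: e -> affine_map f (y \o f) = y.
Proof.
move=> fI ye; apply/funext => w.
have [v /eqP <-|fw] := pickP (fun v => f v == w); first by rewrite affine_map_inj.
rewrite affine_map_out => [|v]; last by rewrite fw.
apply/esym/eqP/negPn/negP => yw.
have : w \in support_set y by rewrite inE.
by rewrite ye => /imsetP[v _ wE]; have := fw v; rewrite wE eqxx.
Qed.

Lemma realization_comp (V W : finType) (K : {set {set V}}) (L : {set {set W}})
    (e : {set V}) (f : V -> W) (y : W -> R) :
  injective f -> e \in K -> support_set y = f @: e -> realization L y ->
  realization K (y \o f).
Proof.
move=> fI eK ye [y0 y1 _]; split.
- by move=> v; exact: y0.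
- rewrite -[RHS]y1 -{2}(affine_map_comp fI ye) /affine_map.
  by rewrite [LHS](partition_big f xpredT).
- by rewrite (support_comp fI ye).
Qed.

(** Open simplices are nonempty, so distinct faces give distinct cells. *)
Lemma barycenter (V : finType) (K : {set {set V}}) (s : {set V}) :
  s \in K -> s != finset.set0 ->
  exists2 x, @realization R V K x & support_set x = s.
Proof.
move=> sK s0; have cs : #|s|%:R != 0 :> R by rewrite pnatr_eq0 cards_eq0.
pose x v : R := (v \in s)%:R / #|s|%:R.
have xs : support_set x = s.
  apply/setP => v; rewrite inE /x.
  by case: (v \in s); rewrite ?mul0r ?eqxx ?mul1r ?invr_eq0.
exists x => //; split; last by rewrite xs.
- by move=> v; rewrite divr_ge0 ?ler0n.
- by rewrite -mulr_suml -natr_sum -big_mkcond /= sum1_card mulfV.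
Qed.

End Realization.

Section Cells.
Variables (R : realType) (E : finType) (M : matroid E).
Local Notation Sum := (engstrom_sum R M).
Implicit Types (p q : flat M) (s t : {set flat M}).

Lemma d_vertex_inj p q (qp : val q \subset val p) : injective (d_vertex qp).
Proof.
move=> [i b] [j c] /= [ij bc]; rewrite /d_vertex /= in ij bc.
by congr (_, _) => //; exact: val_inj.
Qed.

Lemma d_vertex_face p q (qp : val q \subset val p) (e : {set 'I_(corank p) * bool}) :
  e \in D_complex p -> d_vertex qp @: e \in D_complex q.
Proof.
rewrite !inE => /forallP eD; apply/forallP => j; rewrite inE.
have [i /eqP ij|ij] := pickP (fun i => widen_ord (corankS qp) i == j).
  rewrite (_ : [set b | _]%SET = [set b | (i, b) \in e]%SET).
    by have := eD i; rewrite inE.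
  apply/setP => b; rewrite !inE -(mem_imset e _ (@d_vertex_inj _ _ qp)).
  by rewrite /d_vertex /= ij.
rewrite (_ : [set b | _]%SET = finset.set0) ?cards0 //.
apply/setP => b; rewrite !inE; apply/imsetP => -[[i c] _ [ji _]].
by have := ij i; rewrite ji eqxx.
Qed.

(** The barycentric coordinates of the point of [D p], extended by 0 to all
    indices.  They live in a space that does not depend on [p], which makes them
    comparable across the summands; the gluing maps preserve them. *)
Definition join_coord (u : Sum) (i : nat) (b : bool) : R :=
  if insub i is Some j then set_val (projT2 u).2 (j, b) else 0.

Definition chain_coord (u : Sum) : flat M -> R := set_val (projT2 u).1.

Lemma engstrom_step_coord (u v : Sum) : engstrom_step u v ->
  join_coord u = join_coord v /\ chain_coord u = chain_coord v.
Proof.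
move: u v => [p [a x]] [q [b y]] [/= qp [xy ab]]; split; last exact: ab.
apply/funext => i; apply/funext => c; rewrite /join_coord /=.
have dI := @d_vertex_inj _ _ qp.
case: insubP => [j ip ji|ip].
  have iq : (i < corank q)%N by apply: leq_trans (corankS qp).
  rewrite (insubT (fun k => k < corank q)%N iq) -xy.
  rewrite -[LHS](affine_map_inj _ _ dI); congr affine_map.
  by congr (_, _); apply: val_inj.
case: insubP => // j iq ji; rewrite -xy affine_map_out // => -[k d].
apply: contra ip => /eqP [/(congr1 val) /= + _]; rewrite ji => <-.
exact: ltn_ord.
Qed.

(** Having equal coordinates is an equivalence relation, so it suffices that the
    generating steps of the gluing preserve them. *)
Lemma engstrom_proj_coord (u v : Sum) : engstrom_proj u = engstrom_proj v ->
  join_coord u = join_coord v /\ chain_coord u = chain_coord v.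
Proof.
move=> /eqquotP /asboolP.
elim=> {u v} [u v|u|u v _ [-> ->]|u v w _ [-> ->] _ [-> ->]] //.
exact: engstrom_step_coord.
Qed.

Lemma engstrom_step_proj (u v : Sum) :
  engstrom_step u v -> engstrom_proj u = engstrom_proj v.
Proof. by move=> uv; apply/eqquotP/asboolP/rst_step. Qed.

Definition cell p s (e : {set 'I_(corank p) * bool}) : set (engstrom_space R M) :=
  @engstrom_proj R E M @` @product_cell R E M p s e.

(** The gluing moves the points of the cell over [p] to points over [q], and every
    point of the cell over [q] arises in this way, because its support lies in the
    image of [d_vertex qp]. *)
Lemma cell_restrict p q (qp : val q \subset val p) s
    (e : {set 'I_(corank p) * bool}) :
  s \in flat_complex q -> e \in D_complex p ->
  cell s e = cell s (d_vertex qp @: e).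
Proof.
move=> sq eD; have dI := @d_vertex_inj _ _ qp.
have sp : s \in flat_complex p.
  move/flat_complexP: sq => [sq sC]; apply/flat_complexP; split=> // q' /sq q'q.
  exact: fintype.subset_trans q'q qp.
apply/seteqP; split=> _ [_ [[a x] [/= -> as_ xe]] <-].
- have ra : realization (flat_complex q) (set_val a).
    by have [a0 a1 _] := set_valP a; split=> //; rewrite as_.
  have rx : realization (D_complex q) (affine_map (d_vertex qp) (set_val x)).
    apply: realization_affine_map (set_valP x) _ => //.
    by rewrite xe d_vertex_face.
  exists (existT _ q (SigSub (mem_set ra), SigSub (mem_set rx))).
    by eexists; split; [reflexivity | | rewrite /= support_affine_map // xe].
  by apply/esym/engstrom_step_proj; exists qp.
- have ra : realization (flat_complex p) (set_val a).
    by have [a0 a1 _] := set_valP a; split=> //; rewrite as_.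
  have rx : realization (D_complex p) (set_val x \o d_vertex qp).
    exact: (realization_comp dI eD xe (set_valP x)).
  exists (existT _ p (SigSub (mem_set ra), SigSub (mem_set rx))).
    by eexists; split; [reflexivity | | exact: support_comp].
  apply: engstrom_step_proj; exists qp; split=> //=.
  exact: affine_map_comp xe.
Qed.

(** The invariants of one point of the cell recover the chain as a support, then
    [p] as the top of the chain, then the face of [D p] as a support. *)
Lemma cell_inj p q s t (e : {set 'I_(corank p) * bool})
    (f : {set 'I_(corank q) * bool}) :
  s \in chains_with_top p -> t \in chains_with_top q ->
  e \in D_complex p -> e != finset.set0 -> cell s e = cell t f ->
  existT (fun p => {set flat M} * {set 'I_(corank p) * bool})%type p (s, e) =
  existT _ q (t, f).
Proof.
move=> sp tq eD e0 st; have /[!chains_with_topE]/andP[sC ps] := sp.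
have [a ra as_] :
    exists2 a, @realization R _ (flat_complex p) a & support_set a = s.
  by apply: barycenter => //; apply/set0Pn; exists p.
have [x rx xe] := @barycenter R _ _ _ eD e0.
pose u : Sum := existT _ p (SigSub (mem_set ra), SigSub (mem_set rx)).
have : cell s e (engstrom_proj u).
  by exists u => //; eexists; split; [reflexivity | |].
rewrite st => -[v [[b y] [/= vE bt yf]] uv].
have [xy ab] := engstrom_proj_coord uv; subst v.
have st' : s = t by rewrite -as_ -bt; congr support_set; exact: esym ab.
have pq : p = q by apply: chain_top_uniq sp _; rewrite st'.
subst q; suff -> : e = f by rewrite st'.
rewrite -xe -yf; congr support_set; apply/funext => -[i c].
by have /(congr1 (fun g => g (val i) c)) := xy; rewrite /join_coord /= !valK.
Qed.

Definition cell_index : finType :=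
  {p : flat M & ({set flat M} * {set 'I_(corank p) * bool})%type}.

(** The normal form of a cell: the smallest possible [p], which is the top of the
    chain, is used as its base. *)
Definition is_cell_index (i : cell_index) : bool :=
  let: existT p (s, e) := i in
  [&& s \in chains_with_top p, e \in D_complex p & e != finset.set0].

Definition indexed_cell (i : cell_index) : set (engstrom_space R M) :=
  cell (tagged i).1 (tagged i).2.

(** Every cell is moved by [cell_restrict] to the top of its chain. *)
Lemma engstrom_cellsE :
  @engstrom_cells R E M = indexed_cell @` [set` is_cell_index].
Proof.
apply/seteqP; split=> C.
- move=> [p [s [e [sC s0 eD e0 ->]]]].
  have [q qp sq] := chain_has_top sC s0.
  exists (existT _ q (s, d_vertex qp @: e)).
    rewrite /= unfold_in /= sq d_vertex_face //=.
    by apply: contraNneq e0 => /eqP; rewrite imset_eq0.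
  rewrite /indexed_cell /= -cell_restrict //.
  by move: sq; rewrite chains_with_topE => /andP[].
- move=> [[p [s e]] /and3P[/= + eD e0] <-].
  rewrite chains_with_topE => /andP[sC ps]; exists p, s, e; split=> //.
  by apply/set0Pn; exists p.
Qed.

(** The face of [D p] ranges over the [3 ^ corank p] faces of a join of copies of
    [S0_complex], minus the empty one. *)
Lemma card_cell_index :
  #|is_cell_index| =
  (\sum_(p : flat M) #|chains_with_top p| * (3 ^ corank p).-1)%N.
Proof.
pose faces p := (D_complex p :\ finset.set0)%SET.
transitivity (\sum_(p : flat M)
    \sum_(x in finset.setX (chains_with_top p) (faces p)) 1)%N.
  rewrite -sum1_card sig_big_dep; apply: eq_bigl => -[p [s e]] /=.
  rewrite unfold_in /= finset.in_setX /faces finset.in_setD1.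
  by rewrite [(e != _) && _]andbC.
apply: eq_bigr => p _; rewrite sum1_card cardsX; congr (_ * _)%N.
have D0 : finset.set0 \in D_complex p.
  rewrite inE; apply/forallP => i; rewrite inE.
  rewrite (_ : [set b | _]%SET = finset.set0) ?cards0 //.
  by apply/setP => b; rewrite !inE.
have := card_join_complex 'I_(corank p) S0_complex.
rewrite card_S0_complex card_ord -/(D_complex p).
by rewrite (cardsD1 finset.set0) D0 => <-.
Qed.

(** By [engstrom_cellsE] and [cell_inj] the cells are in bijection with their
    normal forms. *)
Lemma f_total_engstrom : f_total (engstrom_S0 R M) =
  (\sum_(p : flat M) #|chains_with_top p| * (3 ^ corank p).-1).+1%N.
Proof.
rewrite -card_cell_index /f_total /= engstrom_cellsE; congr _.+1.
have -> : indexed_cell @` [set` is_cell_index] =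
    [set` [fset indexed_cell i | i in enum is_cell_index]%fset].
  apply/seteqP; split=> C /=.
    by move=> [i iP <-]; apply/imfsetP; exists i; rewrite //= mem_enum.
  by move=> /imfsetP[i /= + ->]; rewrite mem_enum; exists i.
rewrite set_fsetK card_in_imfset /=.
  by rewrite undup_id ?enum_uniq // cardE.
have valid k : mem_seq (enum is_cell_index) k -> is_cell_index k.
  by rewrite -[mem_seq _ k]/(k \in enum _) mem_enum.
move=> [p [s e]] [q [t f]] /valid/and3P[sp eD e0] /valid/and3P[tq _ _].
exact: cell_inj.
Qed.

End Cells.

(** * Binomial polynomials and the count *)

Definition binomial_poly (k : nat) : {poly rat} :=
  k`!%:R^-1 *: \prod_(i < k) ('X - i%:R%:P).

Lemma fact_rat_neq0 k : k`!%:R != 0 :> rat.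
Proof. by rewrite pnatr_eq0 -lt0n fact_gt0. Qed.

Lemma horner_binomial_poly k n : (binomial_poly k).[n%:R] = 'C(n, k)%:R.
Proof.
have prodE : \prod_(i < k) (n%:R - i%:R) = (n ^_ k)%:R :> rat.
  elim: k => [|k IH]; first by rewrite big_ord0.
  rewrite big_ord_recr /= IH ffactnSr natrM.
  by have [nk|kn] := ltnP n k; [rewrite ffact_small // !mul0r | rewrite natrB].
rewrite hornerZ horner_prod; under eq_bigr do rewrite hornerXsubC.
by rewrite prodE -bin_ffact natrM mulrC mulfK ?fact_rat_neq0.
Qed.

Lemma size_binomial_poly k : size (binomial_poly k) = k.+1.
Proof.
rewrite size_scale ?invr_eq0 ?fact_rat_neq0 // size_prod_XsubC.
by rewrite [index_enum _]unlock -enumT size_enum_ord.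
Qed.

Lemma lead_coef_binomial_poly k : lead_coef (binomial_poly k) = k`!%:R^-1.
Proof. by rewrite lead_coefZ (monicP (monic_prod_XsubC _ _ _)) mulr1. Qed.

(** In a combination of binomial polynomials only the last one reaches the top
    degree. *)
Lemma binomial_sum_polynomial (d : nat) (c : nat -> rat) : c d != 0 ->
  let P := \sum_(k < d.+1) c k *: binomial_poly k in
  [/\ forall n : nat, P.[n%:R] = \sum_(k < d.+1) c k * 'C(n, k)%:R,
      size P = d.+1 & lead_coef P = c d / d`!%:R].
Proof.
move=> cd P.
pose Q := \sum_(k < d) c k *: binomial_poly k.
have PE : P = c d *: binomial_poly d + Q by rewrite addrC /P big_ord_recr.
have Qd : (size Q < size (c d *: binomial_poly d))%N.
  rewrite size_scale // size_binomial_poly ltnS.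
  apply: (leq_trans (size_sum _ _ _)); apply/bigmax_leqP => k _.
  by rewrite (leq_trans (size_scale_leq _ _)) // size_binomial_poly.
split.
- move=> n; rewrite horner_sum; apply: eq_bigr => k _.
  by rewrite hornerZ horner_binomial_poly.
- by rewrite PE size_polyDl // size_scale // size_binomial_poly.
- by rewrite PE lead_coefDl // lead_coefZ lead_coef_binomial_poly.
Qed.

Theorem lemma3p5 (R : realType) (r : nat) (r_gt0 : (0 < r)%N) :
  exists P : {poly rat},
    [/\ forall n : nat, (r <= n)%N ->
          (f_total (engstrom_S0 R (uniform_matroid r n)))%:R = P.[n%:R],
        size P = r
      & (1 < r)%N ->
          lead_coef P = (4 * ordered_bell r.-1)%:R / (r.-1)`!%:R].
Proof.
case: r r_gt0 => // d _.
pose w k := (boolean_chains k * (3 ^ (d.+1 - k)).-1)%N.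
(* The empty face is absorbed in the coefficient of [binomial_poly 0]. *)
pose c k : rat := (w k + (k == 0))%:R.
have cd : c d != 0.
  rewrite /c /w pnatr_eq0 -lt0n subSnn addn_gt0 /boolean_chains !muln_gt0.
  by rewrite ordered_bell_gt0.
have [PE Psize Plead] := binomial_sum_polynomial cd.
exists (\sum_(k < d.+1) c k *: binomial_poly k); split=> [n rn||d1] //.
- rewrite PE f_total_engstrom sum_chains_uniform // -addn1.
  rewrite !big_ord_recl /c subn0 !bin0 eqxx mulr1 mul1n addnAC natrD.
  congr (_ + _).
  rewrite natr_sum; apply: eq_bigr => k _; rewrite lift0 addn0.
  by rewrite natrM mulrC.
- rewrite Plead /c /w subSnn /boolean_chains; congr (_%:R / _).
  by case: d d1 {w c cd PE Psize Plead} => //= d _; rewrite addn0 mulnAC.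
Qed.
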